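(* Let $A,B\in\mathbb{Z}$ with $A\equiv B\equiv 1\pmod 4$, and let $\mathcal{F}_{2,A,B}(x)=x^{4}+Ax^{3}+Bx^{2}+Ax+1$. Then $\mathcal{F}_{2,A,B}(x)$ is monogenic with Galois group over $\mathbb{Q}$ isomorphic to the cyclic group $C_4$ if and only if $A=B=1$.
   Context: A monic polynomial $f(x)\in\mathbb{Z}[x]$ is called monogenic if $f(x)$ is irreducible over $\mathbb{Q}$ and $\{1,\theta,\ldots,\theta^{\deg f-1}\}$ is a $\mathbb{Z}$-basis of the ring of integers of $\mathbb{Q}(\theta)$, where $f(\theta)=0$. *)

(* Defs.v *)
From HB Require Import structures.
From mathcomp Require Import all_boot all_order all_algebra all_fingroup.
From mathcomp Require Import all_solvable all_field.

Set Implicit Arguments.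
Unset Strict Implicit.
Unset Printing Implicit Defensive.

Import Order.TTheory GRing.Theory Num.Theory.
Local Open Scope ring_scope.

Definition toQ (f : {poly int}) : {poly rat} := map_poly intr f.

Definition is_Zbasis (V : zmodType) (n : nat) (b : 'I_n -> V) (M : V -> Prop)
    : Prop :=
  (forall i : 'I_n, M (b i)) /\
  (forall z : V, M z ->
     exists! c : {ffun 'I_n -> int}, z = \sum_(i < n) b i *~ c i).

Definition ring_of_integers (K : fieldExtType rat) (E : {subfield K}) (z : K)
    : Prop :=
  z \in E /\ integralOver (intr : int -> K) z.

(* Once f is irreducible, Q(theta) does not depend, up to isomorphism, on the
   root theta nor on the ambient number field K, so the existential could
   equivalently be universal. The degree of f is (size f).-1. *)
Definition monogenic (f : {poly int}) : Prop :=
  [/\ f \is monic,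
      irreducible_poly (toQ f) &
      exists (K : fieldExtType rat) (theta : K),
        root (map_poly intr f) theta /\
        is_Zbasis (fun i : 'I_(size f).-1 => theta ^+ i)
                  (ring_of_integers <<1; theta>>%AS)].

(* The splitting field L is unique up to isomorphism, and so is the group. *)
Definition Galois_group_isog (f : {poly int}) (gT : finGroupType)
    (G : {group gT}) : Prop :=
  exists L : splittingFieldType rat,
    splittingFieldFor 1 (map_poly intr f : {poly L}) {:L} /\
    ('Gal({:L} / 1) \isog G)%g.

Definition quarticF (A B : int) : {poly int} :=
  'X^4 + A *: 'X^3 + B *: 'X^2 + A *: 'X + 1.

(* Main.v *)
Require Import Defs.
From HB Require Import structures.
From mathcomp Require Import all_boot all_order all_algebra all_fingroup.
From mathcomp Require Import all_solvable all_field.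
From mathcomp Require Import all_character zify ring.

Set Implicit Arguments.
Unset Strict Implicit.
Unset Printing Implicit Defensive.

Import Order.TTheory GRing.Theory Num.Theory.
Local Open Scope ring_scope.

(* Put t = u + 1/u for a root u, so t^2 + A t + B - 2 = 0, and let
   W = A^2 - 4B + 8, F = f(1) = B + 2 + 2A and F' = f(-1) = B + 2 - 2A.

   If f is monogenic then W, F and F' are squarefree: a square factor d^2 of one
   of them yields an explicit g in Z[x] with (g(u)/d)^2 in Z[u] although d does
   not divide the coefficients of g.  If the Galois group is cyclic of order 4
   with generator s, then s negates both t - s t, whose square is W, and
   (u - 1/u)(s u - 1/(s u)), whose square is F F', so W F F' is a square.

   Squarefreeness then gives F F' = W e^2; as (B - 6)^2 = W (e^2 + 4), also
   B - 6 = h W, so that h^2 W = e^2 + 4.  Moreover e divides F and F', hence A,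
   and A^2 = W + 16 + 4 h W forces e | 2h + 1.  This bounds h, and the
   congruences modulo 4 then leave only h = -1, W = 5.

   Conversely f = Phi_5.  For z = sum q_j w^j integral in Q(w), the trace of
   z (w^(-j) - w) is 5 q_j, so 5 z lies in Z[w]; expanding 5 z in powers of
   1 - w, the coefficients are successively seen to be divisible by 5, because
   (1 - w)^4 is 5 times a unit. *)

(** * The integer equations *)

Definition squarefreez (x : int) : Prop :=
  forall d : int, (d * d %| x)%Z -> (d %| 1)%Z.

Lemma gcdz_cofactors (a b : int) : a != 0 ->
  exists g a' b', [/\ g != 0, a = a' * g, b = b' * g & coprimez a' b'].
Proof.
move=> a0; set g := gcdz a b.
have g0 : g != 0 by rewrite gcdz_eq0 (negPf a0).
have /dvdzP[a' Ea] := dvdz_gcdl a b; have /dvdzP[b' Eb] := dvdz_gcdr a b.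
exists g, a', b'; split=> //.
have [u [v E]] := Bezoutz a b.
apply/coprimezP; exists (u, v) => /=; apply: (mulIf g0).
by rewrite mul1r mulrDl -!mulrA -Ea -Eb.
Qed.

(** Removing the gcd [g] leaves [w'] coprime to [x'], so [w'] divides [g]. Then the square of [w']
    divides [w], and [w'] is a unit. *)
Lemma squarefreez_dvd (w x : int) : w != 0 -> squarefreez w -> (w %| x * x)%Z -> (w %| x)%Z.
Proof.
move=> w0 sfw; have [g [w' [x' [g0 Ew Ex cop]]]] := gcdz_cofactors x w0.
rewrite Ex Ew -mulrA [g * _]mulrC !mulrA dvdz_mul2r // -mulrA (Gauss_dvdzr _ cop).
rewrite (Gauss_dvdzr _ cop) => /dvdzP[q Eg].
have w1 : (w' %| 1)%Z by apply: sfw; rewrite Ew Eg; apply/dvdzP; exists q; ring.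
by rewrite dvdz_mul2r //; apply: dvdz_trans w1 (dvd1z _).
Qed.

(** After removing the gcd of [e] and [x], the square of [e'] divides [x' * y] and is coprime to
    [x'], so it divides [y]. Hence [e'] is a unit. *)
Lemma squarefreez_sqr_dvdM (e x y : int) : e != 0 -> squarefreez x -> squarefreez y ->
  (e * e %| x * y)%Z -> (e %| x)%Z.
Proof.
move=> e0 sfx sfy; have [g [e' [x' [g0 Ee Ex cop]]]] := gcdz_cofactors x e0.
have -> : e * e = g * (e' * e' * g) by rewrite Ee; ring.
have -> : x * y = g * (x' * y) by rewrite Ex; ring.
rewrite dvdz_mul2l // => /(dvdz_trans (dvdz_mulr _ (dvdzz _))).
rewrite Gauss_dvdzr ?coprimezMl ?cop // => /sfy e1.
by rewrite Ee Ex dvdz_mul2r //; apply: dvdz_trans e1 (dvd1z _).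
Qed.

Lemma odd_divisor (e r m : int) : e * r = 2 * m + 1 -> exists k, e = 2 * k + 1.
Proof.
move=> Er; exists (e %/ 2)%Z; have De := divz_eq e 2.
have [e0|e1] : (e %% 2 = 0)%Z \/ (e %% 2 = 1)%Z by lia.
  have : 2 * ((e %/ 2)%Z * r - m) = 1.
    by move: De Er; rewrite e0 addr0; move: (e %/ 2)%Z => k -> E; lia.
  by lia.
by rewrite {1}De e1 mulrC.
Qed.

(** Eliminating [e] bounds [h], and the congruence leaves [h = -1] or [h = 3]. In the latter case
    [e] divides 7, but neither 1 + 4 nor 49 + 4 is a multiple of 9. *)
Lemma small_solutions (e h r W : int) :
    (h = 3 %[mod 4])%Z -> h * h * W = e * e + 4 -> e * r = 2 * h + 1 ->
  h = -1 /\ W = 5.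
Proof.
move=> hh EhW Er.
have Er2 : (e * e) * (r * r) = (2 * h + 1) * (2 * h + 1).
  by rewrite -Er; clear; ring.
have [k Ek] : exists k, h = 4 * k + 3 by exists (h %/ 4)%Z; lia.
have [r' Er'] : exists r', r = 2 * r' + 1.
  by rewrite mulrC in Er; apply: odd_divisor Er.
have Wpos : 0 < W by clear -EhW; nia.
have [h_lo h_hi] : -3 < h /\ h < 6.
  have [r1|r9] : r * r = 1 \/ 9 <= r * r.
    have [->|[->|]] : r = 1 \/ r = -1 \/ (r <= -3 \/ 3 <= r) by lia.
    - by left.
    - by left.
    by clear; right; nia.
  (* Here [(W - 4) h^2 = 4 h + 5], which is odd, hence nonzero, so [h^2] is at most [|4 h + 5|]. *)
  - rewrite r1 mulr1 in Er2.
    have : (W - 4) * (h * h) = 4 * h + 5.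
      by rewrite mulrBl [W * _]mulrC EhW Er2; clear; ring.
    clear -Ek; move: (W - 4) => w E.
    have w0 : w <> 0 by move=> w0; rewrite w0 in E; lia.
    have : h * h <= 4 * h + 5 \/ h * h <= - 4 * h - 5 by clear Ek; nia.
    by clear -Ek; case; nia.
  (* Since [W >= 1], here [9 (h^2 - 4) <= 9 e^2 <= (2 h + 1)^2]. *)
  - have : 9 * (e * e) <= (2 * h + 1) * (2 * h + 1) by rewrite -Er2; clear -r9; nia.
    have : h * h <= e * e + 4 by rewrite -EhW; clear -Wpos; nia.
    by clear; move: (e * e) => u ? ?; split; nia.
have De x n : e * x = n%:Z -> (0 < n)%N -> `|e|%N \in divisors n.
  move=> En n0; rewrite -dvdn_divisors // -[n]/(`|n%:Z|%N) -dvdzE -En.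
  exact: dvdz_mulr.
have [h1|h3] : h = -1 \/ h = 3 by clear -Ek h_lo h_hi; lia.
- have := De (- r) 1%N; rewrite mulrN Er h1 => /(_ erefl erefl).
  rewrite (_ : divisors 1 = [:: 1]%N) // !inE => /eqP e1.
  have {e1} [e1|e1] : e = 1 \/ e = -1 by clear -e1; lia.
    by move: EhW; rewrite e1 h1; clear; lia.
  by move: EhW; rewrite e1 h1; clear; lia.
have := De r 7%N; rewrite Er h3 => /(_ erefl erefl).
rewrite (_ : divisors 7 = [:: 1; 7]%N) // !inE => e17.
have {e17} [e1|[e1|[e1|e1]]] : e = 1 \/ e = -1 \/ e = 7 \/ e = -7 by clear -e17; lia.
all: by move: EhW; rewrite e1 h3; clear; lia.
Qed.

Lemma cyclic_quartic_arith (A B X : int) :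
    (A = 1 %[mod 4])%Z -> (B = 1 %[mod 4])%Z ->
    squarefreez (A ^+ 2 - 4 * B + 8) ->
    squarefreez (B + 2 + 2 * A) -> squarefreez (B + 2 - 2 * A) ->
    (A ^+ 2 - 4 * B + 8) * ((B + 2 + 2 * A) * (B + 2 - 2 * A)) = X * X ->
  A = 1 /\ B = 1.
Proof.
move=> hA hB; set W := A ^+ 2 - 4 * B + 8 => sfW sf1 sfm EX.
have [a Ea] : exists a, A = 4 * a + 1 by exists (A %/ 4)%Z; lia.
have [b Eb] : exists b, B = 4 * b + 1 by exists (B %/ 4)%Z; lia.
have W0 : W != 0 by apply/eqP; rewrite /W Ea Eb; nia.
have /dvdzP[e Ee] : (W %| X)%Z.
  by apply: squarefreez_dvd => //; rewrite -EX dvdz_mulr.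
have EN : (B + 2 + 2 * A) * (B + 2 - 2 * A) = W * (e * e).
  by apply: (mulfI W0); rewrite EX Ee; ring.
(* This is the identity [(B - 6)^2 = F F' + 4 W]. *)
have Esq : (B - 6) * (B - 6) = (e * e + 4) * W.
  have -> : (e * e + 4) * W = W * (e * e) + 4 * W by ring.
  by rewrite -EN /W; ring.
have /dvdzP[h Eh] : (W %| B - 6)%Z.
  by apply: squarefreez_dvd => //; rewrite Esq dvdz_mull.
have EhW : h * h * W = e * e + 4.
  by apply: (mulIf W0); rewrite -Esq Eh; ring.
have EA : A * A = W + 16 + 4 * h * W.
  by rewrite -mulrA -Eh /W; ring.
have e0 : e != 0.
  by apply/eqP=> e0; move: EN; rewrite e0 Ea Eb; nia.
have ee : (e * e %| (B + 2 + 2 * A) * (B + 2 - 2 * A))%Z by rewrite EN dvdz_mull.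
have e1 := squarefreez_sqr_dvdM e0 sf1 sfm ee.
rewrite mulrC in ee; have em := squarefreez_sqr_dvdM e0 sfm sf1 ee.
(* [e] divides [F], and [F = 4 (2 a + b + 1) + 1]. *)
have cop4 : coprimez e 4.
  have /dvdzP[q Eq] := e1.
  apply/coprimezP; exists (q, - (2 * a + b + 1)) => /=.
  by rewrite -Eq Ea Eb; ring.
have /dvdzP[a' Ea'] : (e %| A)%Z.
  rewrite -(Gauss_dvdzr _ cop4).
  have -> : 4 * A = (B + 2 + 2 * A) - (B + 2 - 2 * A) by ring.
  by apply: rpredB.
(* Multiply [EA] by [h^2] and replace [h^2 W] by 4 modulo [e^2]: [h^2 A^2] becomes [4 (2 h + 1)^2].
   As [e] divides [A] and is coprime to 4, [e^2] divides [(2 h + 1)^2]. *)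
have /dvdzP[r Er] : (e %| 2 * h + 1)%Z.
  rewrite -(@dvdz_pexp2r _ _ 2) // -(@Gauss_dvdzr _ 4) ?coprimezXl //.
  apply/dvdzP; exists (h * h * (a' * a') - 4 * h - 1).
  have E4 : 4 * (2 * h + 1) ^+ 2 =
     h * h * (W + 16 + 4 * h * W) - (1 + 4 * h) * (h * h * W) + 4 * (1 + 4 * h).
    by clearbody W; ring.
  by rewrite {}E4 -EA EhW Ea'; clear; ring.
have We : W = 4 * (4 * a * a + 2 * a - 4 * b + 1) + 1.
  by rewrite /W Ea Eb; clear; ring.
have h3 : (h = 3 %[mod 4])%Z.
  (* Both [B] and [W] are 1 modulo 4, so [h] is congruent to -5. *)
  have : h = B - 6 - h * (W - 1) by rewrite Eh; clearbody W; clear; ring.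
  rewrite We Eb addrK mulrCA; move: (h * _) => u; clear; lia.
rewrite [r * e]mulrC in Er; have [h1 W5] := small_solutions h3 EhW (esym Er).
move: EA Eh; rewrite h1 W5 => EA Eh; split; last by clear -Eh; lia.
have /eqP : A ^+ 2 = 1 by rewrite expr2 EA.
by rewrite sqrf_eq1 => /orP[] /eqP // A1; clear -A1 Ea; lia.
Qed.

(** * Monogenic polynomials *)

(** If [f] and [r] were coprime, a Bezout relation evaluated at [u] would read 0 = 1. *)
Lemma irreducible_root_dvdp (F : fieldType) (K : fieldExtType F) (f r : {poly F})
    (u : K) :
    irreducible_poly f -> root (map_poly (in_alg K) f) u ->
    root (map_poly (in_alg K) r) u ->
  f %| r.
Proof.
move=> [f1 irrf] fu ru; have szg : size (gcdp f r) != 1%N.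
  apply/negP; rewrite -[_ == _]/(coprimep f r) => /Bezout_eq1_coprimepP[[a b] /= E].
  have := congr1 (fun q => (map_poly (in_alg K) q).[u]) E.
  rewrite rmorphD !rmorphM /= hornerD !hornerM (rootP fu) (rootP ru) !mulr0 addr0.
  by rewrite rmorph1 hornerC => /esym/eqP; rewrite oner_eq0.
by rewrite -(eqp_dvdl _ (irrf _ szg (dvdp_gcdl f r))) dvdp_gcdr.
Qed.

Lemma irreducible_root_size (F : fieldType) (K : fieldExtType F) (f r : {poly F})
    (u : K) :
    irreducible_poly f -> root (map_poly (in_alg K) f) u ->
    (size r < size f)%N -> root (map_poly (in_alg K) r) u ->
  r = 0.
Proof.
move=> irrf fu szr ru; have fr := irreducible_root_dvdp irrf fu ru.
by apply: contraTeq szr => r0; rewrite -leqNgt dvdp_leq.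
Qed.

Lemma map_intr_toQ (K : fieldExtType rat) (f : {poly int}) :
  map_poly intr f = map_poly (in_alg K) (toQ f).
Proof.
by rewrite -map_poly_comp; apply: eq_map_poly => x; rewrite -[RHS]/(in_alg K _) rmorph_int.
Qed.

Lemma size_toQ (f : {poly int}) : size (toQ f) = size f.
Proof. by rewrite size_map_inj_poly //; apply: intr_inj. Qed.

Lemma toQ_inj : injective toQ.
Proof. by apply: map_inj_poly => //; apply: intr_inj. Qed.

Lemma intr_root_size (K : fieldExtType rat) (f r : {poly int}) (u : K) :
    irreducible_poly (toQ f) -> root (map_poly intr f) u ->
    (size r < size f)%N -> root (map_poly intr r) u ->
  r = 0.
Proof.
rewrite !map_intr_toQ -!(size_toQ) => irrf fu szr ru.
by apply: toQ_inj; rewrite (irreducible_root_size irrf fu szr ru) /toQ rmorph0.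
Qed.

Lemma integral_intr_horner (K : fieldExtType rat) (g : {poly int}) (u : K) :
  integralOver (intr : int -> K) u -> integralOver (intr : int -> K) (map_poly intr g).[u].
Proof.
apply: integral_horner; apply/integral_poly => i.
by rewrite coef_map; apply: integral_id.
Qed.

Lemma integral_exp (R : comNzRingType) (K : fieldType) (i : {rmorphism R -> K}) (z : K) n :
  (0 < n)%N -> integralOver i (z ^+ n) -> integralOver i z.
Proof.
move=> n0 iz; apply: (@integral_root_monic _ _ _ z ('X^n - (z ^+ n)%:P)).
- by apply: monicXnsubC.
- by rewrite rootE !hornerE subrr.
apply/integral_poly => j; rewrite coefB coefC coefXn.
apply: integral_sub; first exact: integral_nat.
by case: ifP => _ //; apply: integral0.
Qed.

Lemma fieldExt_intr_eq0 (K : fieldExtType rat) (p : int) : (p%:~R == 0 :> K) = (p == 0).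
Proof. by rewrite -(rmorph_int (in_alg K)) fmorph_eq0 intr_eq0. Qed.

(** Coefficients are indexed by naturals and coordinates by ordinals, hence [insub]; its default 0
    is never reached below [n]. *)
Definition poly_of_ffun n (c : {ffun 'I_n -> int}) : {poly int} :=
  \poly_(j < n) (if insub j is Some k then c k else 0).

Lemma horner_poly_of_ffun (K : nzRingType) n (c : {ffun 'I_n -> int}) (u : K) :
  (map_poly intr (poly_of_ffun c)).[u] = \sum_(i < n) u ^+ i *~ c i.
Proof.
rewrite (@horner_coef_wide _ n); last first.
  by rewrite (leq_trans (size_poly _ _)) // size_poly.
apply: eq_bigr => j _; rewrite coef_map coef_poly ltn_ord valK /=.
by rewrite mulrzl.
Qed.

(** At a root [u] of [f], the square of [g(u) / p] is [G(u)], so [g(u) / p] is integral. Its integer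
    coordinates form a polynomial [r] such that [g - p r] vanishes at [u]; the degree being less
    than that of [f], [g = p r]. *)
Lemma monogenic_dvd_coef (f g G H : {poly int}) (p : int) :
    monogenic f -> p != 0 -> (size g < size f)%N ->
    g ^+ 2 = p ^+ 2 *: G + f * H ->
  forall i, (p %| g`_i)%Z.
Proof.
move=> [monf irrf [K [u [fu [_ ubasis]]]]] p0 szg Eg i.
set E := <<1; u>>%AS in ubasis.
have pK0 : p%:~R != 0 :> K by rewrite fieldExt_intr_eq0.
have iu : integralOver (intr : int -> K) u by exists f.
pose ev (h : {poly int}) : K := (map_poly intr h).[u].
have evE h : ev h \in E.
  apply: rpred_horner; last exact: memv_adjoin.
  by apply/polyOverP => j; rewrite coef_map /= rpred_int.
pose z := ev g / p%:~R.
have zE : z \in E by rewrite rpred_div ?rpred_int.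
have iz : integralOver (intr : int -> K) z.
  apply: (@integral_exp _ _ _ _ 2) => //.
  suff -> : z ^+ 2 = ev G by apply: integral_intr_horner.
  have := congr1 ev Eg.
  rewrite /ev rmorphD rmorphXn /= map_polyZ (rmorphM _ f H) hornerD hornerZ.
  rewrite (hornerM (map_poly _ f)) (rootP fu) mul0r addr0 horner_exp rmorphXn /= => Ez.
  by rewrite expr_div_n Ez mulrC mulKf ?expf_neq0.
have [c [Ec _]] := ubasis z (conj zE iz).
pose r := poly_of_ffun c.
suff /eqP : g - p *: r = 0.
  by rewrite subr_eq0 => /eqP ->; rewrite coefZ; apply: dvdz_mulr.
have sf : (0 < size f)%N by apply: leq_ltn_trans szg.
apply: (intr_root_size irrf fu).
  rewrite (leq_ltn_trans (size_polyD _ _)) // size_polyN gtn_max szg /=.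
  rewrite (leq_ltn_trans (size_scale_leq _ _)) //.
  by rewrite (leq_ltn_trans (size_poly _ _)) // prednK.
rewrite rootE rmorphB /= map_polyZ hornerD hornerN hornerZ -/(ev g).
by rewrite horner_poly_of_ffun -Ec mulrC divfK // subrr.
Qed.

Lemma quarticFE (A B : int) : quarticF A B = Poly [:: 1; A; B; A; 1].
Proof.
by rewrite /quarticF /= !cons_poly_def -!mul_polyC; ring.
Qed.

Lemma polyseq_quarticF (A B : int) : quarticF A B = [:: 1; A; B; A; 1] :> seq int.
Proof. by rewrite quarticFE (@PolyK _ 0) ?oner_eq0. Qed.

(** The number is f(s) for s = 1 or -1. Modulo f, [g ^+ 2 = (y * g) * r] is a multiple of f(s),
    hence of [d^2]; since [g] is monic, [d] divides 1. *)
Lemma monogenic_squarefree_eval (A B s : int) :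
    monogenic (quarticF A B) -> s ^+ 2 == 1 -> B + 2 + 2 * s * A != 0 ->
  squarefreez (B + 2 + 2 * s * A).
Proof.
rewrite sqrf_eq1 => mon s2 f0 d /dvdzP[k Ek].
have d0 : d != 0 by apply: contraNneq f0 => d0; rewrite Ek d0 !mulr0.
(* Since f'(s) = 2 s f(s), with y = x - s we have y g = - f(s) (2 s y + 1) modulo f. *)
pose c3 := 4 * s + A; pose c2 := 6 + 3 * s * A + B.
pose y : {poly int} := 'X - s%:P.
(* The Taylor expansion of f at [s] is [y^2 r + f'(s) y + f(s)]. *)
pose r := y ^+ 2 + c3%:P * y + c2%:P.
pose g : {poly int} := Poly [:: - s * (s ^+ 2 - c3 * s + c2);
  3 * s ^+ 2 - 2 * c3 * s + c2; c3 - 3 * s; 1].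
have := @monogenic_dvd_coef (quarticF A B) g (- (k%:P * (2 * s%:P * y + 1) * r)) r d mon d0.
move/(_ _ _ 3%N); rewrite coef_Poly; apply.
  by rewrite polyseq_quarticF (leq_ltn_trans (size_Poly _)).
have gE : g = y * r.
  by rewrite /g /r /y /= !cons_poly_def; ring.
have : quarticF A B = y * g + (B + 2 + 2 * s * A)%:P * (2 * s%:P * y + 1).
  rewrite gE /r /y /c2 /c3 quarticFE /= !cons_poly_def.
  by case/orP: s2 => /eqP ->; clear; ring.
by rewrite Ek => ->; rewrite gE -mul_polyC; clear; ring.
Qed.

(** W is the discriminant of the quadratic satisfied by t = u + 1/u, so [(2 t + A)^2 = W]. The
    leading coefficient of [g] only gives that [d] divides 2; the oddness of [A] does the rest. *)
Lemma monogenic_squarefree_disc (A B : int) :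
    monogenic (quarticF A B) -> A ^+ 2 - 4 * B + 8 != 0 -> (A %% 2 = 1)%Z ->
  squarefreez (A ^+ 2 - 4 * B + 8).
Proof.
move=> mon f0 oA d /dvdzP[k Ek].
have d0 : d != 0 by apply: contraNneq f0 => d0; rewrite Ek d0 !mulr0.
(* Since 1/u = - (u^3 + A u^2 + B u + A), the value of g at u is - (2 (u + 1/u) + A). *)
pose g : {poly int} := Poly [:: A; 2 * B - 2; 2 * A; 2].
have := @monogenic_dvd_coef (quarticF A B) g k%:P
   (Poly [:: 4 * B - 8; 4 * A; 4]) d mon d0.
move/(_ _ _ 3%N); rewrite coef_Poly => H.
have {H} d2 : (d %| 2)%Z.
  apply: H; first by rewrite polyseq_quarticF (leq_ltn_trans (size_Poly _)).
  rewrite -mul_polyC -rmorphM [d ^+ 2 * k]mulrC -[d ^+ 2]/(d * d) -Ek.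
  by rewrite /g quarticFE /= !cons_poly_def; ring.
have /dvdzP[m Em] : (d %| A ^+ 2)%Z.
  have -> : A ^+ 2 = k * d * d + 2 * (2 * B - 4) by rewrite -[k * d * d]mulrA -Ek; ring.
  exact: rpredD (dvdz_mull _ (dvdzz d)) (dvdz_mulr _ d2).
(* With [A = 2 a + 1], [A^2 - 2 (2 a^2 + 2 a) = 1]. *)
have := rpredB (dvdz_mull m (dvdzz d))
  (dvdz_mulr (2 * (A %/ 2)%Z ^+ 2 + 2 * (A %/ 2)%Z) d2).
by rewrite -Em {1}(divz_eq A 2) oA; congr (d %| _)%Z; ring.
Qed.

(** * Cyclic Galois group *)

(** The monic equation is transported to [algC], where rational algebraic integers are integers. *)
Lemma integral_rat_int (K : fieldExtType rat) (x : rat) :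
  integralOver (intr : int -> K) x%:A -> x \is a Num.int.
Proof.
case=> p monp px; rewrite -Cint_rat; apply: Cint_rat_Aint.
  exact: Crat_rat.
have {}px : root (map_poly intr p) x.
  by move: px; rewrite map_intr_toQ -[x%:A]/(in_alg K x) fmorph_root.
apply: (@root_monic_Aint (map_poly intr p)); last 1 first.
- by apply/polyOverP => i; rewrite coef_map /= intr_int.
- rewrite -(fmorph_root (ratr : rat -> algC)) -map_poly_comp in px.
  apply: etrans px; congr (root _ _); apply: eq_map_poly => i /=.
  by rewrite ratr_int.
- exact: monic_map.
Qed.

Lemma galois1 (L : splittingFieldType rat) : galois 1 {:L}.
Proof.
rewrite /galois subvf normalFieldf andbT /=; apply/separableP => y _.
by apply: pcharf0_separable => p; rewrite pchar_lalg; exact: pchar_num.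
Qed.

Lemma cyclic_Zp_group n : cyclic (Zp_group n).
Proof.
rewrite /= /Zp; case: ifP => _; last exact: cyclic1.
by rewrite Zp_cycle cycle_cyclic.
Qed.

Lemma root_quarticF (L : fieldExtType rat) (A B : int) (u : L) :
  root (map_poly intr (quarticF A B)) u =
  (u ^+ 4 + A%:~R * u ^+ 3 + B%:~R * u ^+ 2 + A%:~R * u + 1 == 0).
Proof.
rewrite rootE /quarticF !rmorphD /= !map_polyZ !map_polyXn map_polyX rmorph1.
by rewrite !hornerE.
Qed.

Lemma fixed_by_generator (L : splittingFieldType rat) (s : gal_of {:L}) (a : L) :
  'Gal({:L} / 1)%g = <[s]>%g -> s a = a -> exists q : rat, a = q%:A.
Proof.
move=> Gs sa; apply/vlineP.
suff: a \in fixedField 'Gal({:L} / 1)%g by rewrite (galois_fixedField (galois1 L)).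
apply/(fixedFieldP (memvf a)) => _ /[!Gs] /cycleP[i ->].
elim: i => [|i IHi]; first by rewrite expg0 gal_id.
by rewrite expgSr galM ?memvf // IHi.
Qed.

Lemma gal_eq1 (L : splittingFieldType rat) (rs : seq L) (s : gal_of {:L}) :
  <<1 & rs>>%VS = {:L}%VS -> {in rs, forall r, s r = r} -> s = 1%g.
Proof.
move=> rsL fix_rs; apply/eqP/gal_eqP => a _; rewrite gal_id.
have /subvP/(_ a (memvf a)) : ({:L} <= fixedField [set s])%VS.
  rewrite -[X in (X <= _)%VS]rsL; apply/Fadjoin_seqP; split; first exact: sub1v.
  by move=> r /fix_rs sr; apply/fixedFieldP => [|_ /set1P -> //]; apply: memvf.
by case/mem_fixedFieldP => _ /(_ _ (set11 _)).
Qed.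

(** The quartic is palindromic: dividing it by [u^2] leaves a quadratic in [u + u^-1]. *)
Lemma quarticF_root_sumV (L : fieldExtType rat) (A B : int) (u : L) :
    root (map_poly intr (quarticF A B)) u ->
  u != 0 /\ (u + u^-1) ^+ 2 + A%:~R * (u + u^-1) + (B%:~R - 2) = 0.
Proof.
rewrite root_quarticF => /eqP fu.
have u0 : u != 0.
  apply/eqP=> u0; move: fu; rewrite u0 !expr0n /= !mulr0 !add0r => /eqP.
  by rewrite oner_eq0.
split=> //; apply: (mulIf (expf_neq0 2 u0)); rewrite mul0r -[RHS]fu.
by field.
Qed.

Lemma add_inv_inj (F : fieldType) (x y : F) : x != 0 -> y != 0 ->
  x + x^-1 = y + y^-1 -> x = y \/ x = y^-1.
Proof.
move=> x0 y0 E.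
have /eqP : (x - y) * (x - y^-1) = 0.
  by rewrite -[RHS](mulr0 x) -(subrr (x + x^-1)) {2}E; field; rewrite x0 y0.
by rewrite mulf_eq0 !subr_eq0 => /orP[] /eqP ->; [left|right].
Qed.

Lemma cyclic_quarticF_square (A B : int) :
    irreducible_poly (toQ (quarticF A B)) ->
    Galois_group_isog (quarticF A B) (Zp_group 4) ->
  exists X : int,
    (A ^+ 2 - 4 * B + 8) * ((B + 2 + 2 * A) * (B + 2 - 2 * A)) = X * X.
Proof.
move=> irrf [L [[rs frs rsL] GZ]].
set f := quarticF A B in irrf frs.
have cG : #|'Gal({:L} / 1)%g| = 4%N by rewrite (card_isog GZ) card_Zp.
have /cyclicP[s Gs] : cyclic 'Gal({:L} / 1)%g.
  by rewrite (isog_cyclic GZ) cyclic_Zp_group.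
have os : #[s]%g = 4%N by rewrite orderE -Gs.
have szf : size f = 5%N by rewrite polyseq_quarticF.
have rootrs r : r \in rs -> root (map_poly intr f : {poly L}) r.
  by rewrite (eqp_root frs) root_prod_XsubC.
have [u urs] : exists u, u \in rs.
  have := eqp_size frs; rewrite size_prod_XsubC map_intr_toQ size_map_poly size_toQ szf.
  by case: (rs) => // u ? _; exists u; rewrite mem_head.
have fu := rootrs u urs.
have [u0 tu] := quarticF_root_sumV fu.
have [t tE] : exists t, t = u + u^-1 by exists (u + u^-1).
rewrite -tE in tu.
have v0 : s u != 0 by rewrite fmorph_eq0.
have Est : s t = s u + (s u)^-1 by rewrite tE rmorphD fmorphV.
(* Otherwise [t] would be a rational [q], and [u] a root of [X^2 - q X + 1], of degree less than
   4. *)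
have tst : s t != t.
  apply/eqP => /(fixed_by_generator Gs)[q Eq].
  have /(congr1 (fun p : {poly rat} => p`_2))/eqP : 'X^2 - q *: 'X + 1 = 0 :> {poly rat}.
    apply: (irreducible_root_size (u := u) irrf).
    - by rewrite -map_intr_toQ.
    - rewrite size_toQ szf; apply/leq_sizeP => j j4.
      by case: j j4 => [|[|[|j]]] // _; rewrite !coefE /= mulr0 subrr.
    rewrite rootE !rmorphD rmorphN /= map_polyXn map_polyZ map_polyX rmorph1 !hornerE.
    by rewrite /= -Eq tE; apply/eqP; field.
  by rewrite !coefE /= mulr0 subr0 addr0 oner_eq0.
have st : s t = - A%:~R - t.
  have stu := congr1 s tu.
  rewrite rmorph0 !rmorphD rmorphXn rmorphM rmorphN !rmorph_int rmorph_nat /= in stu.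
  have /eqP : (s t - t) * (s t + A%:~R + t) = 0.
    by rewrite -[RHS](subrr 0) -{1}stu -tu; ring.
  by rewrite mulf_eq0 subr_eq0 (negPf tst) /= -addrA addr_eq0 opprD => /eqP.
have sst : s (s t) = t by rewrite st rmorphB rmorphN rmorph_int /= st; ring.
(* The square of [s] fixes [t], so it fixes or inverts [u]. If it fixed [u], it would fix every
   root, these being [u], [s u] and their inverses, against the order 4 of [s]. *)
have [ssu|ssu] : s (s u) = u \/ s (s u) = u^-1.
  by apply: add_inv_inj; rewrite ?fmorph_eq0 // -tE -sst Est rmorphD /= fmorphV.
  have s2 : (s * s)%g = 1%g.
    apply: (gal_eq1 rsL) => r rrs.
    rewrite galM ?memvf //.
    have [r0 tr] := quarticF_root_sumV (rootrs r rrs).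
    have /eqP : (r + r^-1 - t) * (r + r^-1 - s t) = 0.
      by rewrite st -[RHS](subrr 0) -{1}tr -tu; ring.
    rewrite mulf_eq0 !subr_eq0 Est tE => /orP[] /eqP.
      by case/(add_inv_inj r0 u0) => ->; rewrite /= ?fmorphV /= ?fmorphV /= ssu.
    by case/(add_inv_inj r0 v0) => ->; rewrite /= ?fmorphV /= ?fmorphV /= ssu.
  by have := order_dvdn s 2; rewrite os expgS expg1 s2 eqxx.
pose d := t - s t; pose g := (u - u^-1) * (s u - (s u)^-1).
have [q Eq] : exists q : rat, d * g = q%:A.
  apply: (fixed_by_generator Gs).
  by rewrite rmorphM /d rmorphB /= sst /g rmorphM !rmorphB /= !fmorphV /= ssu invrK; ring.
have Edg : (d * g) ^+ 2 =
   ((A ^+ 2 - 4 * B + 8) * ((B + 2 + 2 * A) * (B + 2 - 2 * A)))%:~R.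
  (* [(u - 1/u)^2 = t^2 - 4]. As [t] and [s t] are the roots of [x^2 + A x + B - 2], the product is
     the value of that quadratic at 2 times its value at -2, that is [F F']. *)
  have Eg : g ^+ 2 = (t ^+ 2 - 4) * ((s t) ^+ 2 - 4).
    by rewrite Est tE /g; field; rewrite ?u0 ?v0.
  have EB : B%:~R - 2 = - (t ^+ 2 + A%:~R * t) by apply/eqP; rewrite -addr_eq0 addrC tu.
  have {}EB : B%:~R = 2 - (t ^+ 2 + A%:~R * t) by rewrite -EB; ring.
  by rewrite exprMn Eg /d st !(rmorphM, rmorphD, rmorphN, rmorphXn) /= EB; clear; ring.
have iq : q \is a Num.int.
  apply: (@integral_rat_int L); apply: (@integral_exp _ _ _ _ 2) => //.
  by rewrite -Eq Edg; apply: integral_id.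
exists (numq q); apply: (@intr_inj rat); rewrite [RHS]rmorphM /= numqK //.
by apply: (fmorph_inj (in_alg L)); rewrite rmorph_int -Edg Eq rmorphM.
Qed.

(** * The fifth cyclotomic field *)

Lemma irreducible_poly_shift (R : fieldType) (f : {poly R}) (a : R) :
  irreducible_poly (f \Po ('X + a%:P)) -> irreducible_poly f.
Proof.
have szX (p : {poly R}) : size (p \Po ('X + a%:P)) = size p.
  by rewrite size_comp_poly2 // size_XaddC.
move=> [f1 irrf]; split=> [|q q1 qf]; first by rewrite szX in f1.
rewrite -dvdp_size_eqp // -(szX q) -(szX f) dvdp_size_eqp ?dvdp_comp_poly //.
by apply: irrf; rewrite ?szX ?dvdp_comp_poly.
Qed.

(** Eisenstein's criterion at 5 applies after the shift of X to X + 1. *)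
Lemma irreducible_quarticF11 : irreducible_poly (toQ (quarticF 1 1)).
Proof.
apply: (@irreducible_poly_shift _ _ 1).
have -> : toQ (quarticF 1 1) \Po ('X + 1%:P) = toQ (Poly [:: 5; 10; 10; 5; 1]).
  rewrite /toQ -[1%:P]/(1 : {poly rat}).
  have -> : 'X + 1 = map_poly intr ('X + 1 : {poly int}) :> {poly rat}.
    by rewrite rmorphD /= map_polyX rmorph1.
  rewrite -map_comp_poly; congr map_poly.
  rewrite quarticFE /= !cons_poly_def !(comp_polyD, comp_polyM, comp_polyX, comp_polyC).
  by ring.
have E : Poly [:: 5; 10; 10; 5; 1] = [:: 5; 10; 10; 5; 1] :> seq int.
  by rewrite (@PolyK _ 0) ?oner_eq0.
apply/irreducible_rat_int/(@eisenstein_crit 5); rewrite ?lead_coefE ?E //.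
by case=> [|[|[|[|]]]].
Qed.

Lemma quarticF_monic (A B : int) : quarticF A B \is monic.
Proof. by rewrite monicE lead_coefE polyseq_quarticF. Qed.

Section CyclotomicField5.

Variables (L : splittingFieldType rat) (w : L).
Hypothesis prim_w : 5.-primitive_root w.

Let w5 : w ^+ 5 = 1. Proof. exact: prim_expr_order. Qed.

Lemma prim5_sum : 1 + w + w ^+ 2 + w ^+ 3 + w ^+ 4 = 0.
Proof.
have w1 : w - 1 != 0.
  by rewrite subr_eq0 -[w]expr1 -(prim_order_dvd prim_w).
apply: (mulfI w1); rewrite mulr0 -[RHS](subrr 1) -[X in _ = X - 1]w5; ring.
Qed.

Lemma prim5_root : root (map_poly intr (quarticF 1 1)) w.
Proof. by rewrite root_quarticF -prim5_sum; apply/eqP; ring. Qed.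

Notation integral := (integralOver (intr : int -> L)).

Lemma prim5_integral : integral w.
Proof.
exists (quarticF 1 1); last exact: prim5_root.
exact: quarticF_monic.
Qed.

(** The binomial expansion minus the vanishing sum of the powers of [w]. The cofactor of 5 is a
    unit. *)
Lemma one_subw_exp4 : (1 - w) ^+ 4 = 5 * (- w + w ^+ 2 - w ^+ 3).
Proof. by rewrite -[LHS]subr0 -prim5_sum; ring. Qed.

Lemma five_neq0 : 5 != 0 :> L.
Proof. by rewrite (fieldExt_intr_eq0 L 5). Qed.

Lemma integral_expr (x : L) k : integral x -> integral (x ^+ k).
Proof.
move=> ix; elim: k => [|k IHk]; first exact: (integral_nat _ 1).
by rewrite exprS; apply: integral_mul.
Qed.

Lemma integral_1subw : integral (1 - w).
Proof. by apply: integral_sub prim5_integral; exact: (integral_nat _ 1). Qed.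

(* (1 - w)^12 is 125 times a unit, so the fourth power of y shows that b^4 / 5 is
   integral. *)
Lemma dvd5_of_one_subw_exp3 (b : int) (y : L) : integral y ->
  b%:~R * (1 - w) ^+ 3 = 5 * y -> (5 %| b)%Z.
Proof.
move=> iy Eb.
(* [n] inverts [m]: the product is [- w^3 (1 + w) (1 + w^3)], and [1 + w + w^3 + w^4 = - w^2]. *)
pose m := - w + w ^+ 2 - w ^+ 3; pose n := w ^+ 2 * (1 + w) ^+ 2.
have mn : m * n = 1.
  by rewrite -[RHS]addr0 -[X in _ + X](mulr0 (- (w ^+ 3 + 1 - w))) -prim5_sum /m /n; ring.
(* The fourth power of [b (1 - w)^3], times [n^3], is both [125 b^4] and [625 y^4 n^3]. *)
have Eb4 : b%:~R ^+ 4 = 5 * (y ^+ 4 * n ^+ 3).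
  have n5 : 5 ^+ 3 != 0 :> L by rewrite expf_neq0 // five_neq0.
  apply: (mulfI n5); transitivity ((b%:~R * (1 - w) ^+ 3) ^+ 4 * n ^+ 3).
    rewrite exprMn -exprM mulnC exprM one_subw_exp4 -/m.
    by rewrite -[LHS]mulr1 -(expr1n _ 3) -mn; ring.
  by rewrite Eb; ring.
have iw := prim5_integral.
have i_n : integral n.
  apply: integral_mul; apply: integral_expr => //.
  by apply: integral_add => //; apply: (integral_nat _ 1).
have : ((b ^+ 4)%:~R / 5 : rat) \is a Num.int.
  apply: (@integral_rat_int L).
  have -> : ((b ^+ 4)%:~R / 5)%:A = y ^+ 4 * n ^+ 3 :> L.
    rewrite -[LHS]/(in_alg L _) rmorphM rmorph_int fmorphV rmorph_nat rmorphXn /= Eb4.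
    by rewrite mulrC mulKf // five_neq0.
  by apply: integral_mul; apply: integral_expr.
case/intrP=> k Ek; have {}Ek : b ^+ 4 = k * 5.
  have Eq : (b ^+ 4)%:~R = k%:~R * 5 :> rat by have := congr1 ( *%R^~ 5) Ek; rewrite /= divfK.
  by apply/eqP; rewrite -(eqr_int rat) intrM Eq.
have : (5 %| b ^+ 4)%Z by rewrite Ek dvdz_mull.
by rewrite !dvdzE abszX Euclid_dvdX // => /andP[].
Qed.

(** Strong induction on [i], multiplying by [(1 - w)^(3 - i)]: terms of index below [i] are
    multiples of 5 by induction, those above contain [(1 - w)^4], and what remains is
    [b_i (1 - w)^3]. *)
Lemma dvd5_one_subw_coef (b : nat -> int) (z : L) : integral z ->
    5 * z = \sum_(i < 4) (b i)%:~R * (1 - w) ^+ i ->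
  forall i, (i < 4)%N -> (5 %| b i)%Z.
Proof.
move=> iz Ez.
pose m := - w + w ^+ 2 - w ^+ 3.
have im : integral m.
  have iw := prim5_integral.
  apply: integral_sub; last exact: integral_expr.
  by apply: integral_add; [apply: integral_opp | apply: integral_expr].
elim/ltn_ind => i IHi i4; pose i' := Ordinal i4.
pose y := z * (1 - w) ^+ (3 - i) - \sum_(j < 4 | j != i')
  (if (j < i)%N then (b j %/ 5)%Z%:~R * (1 - w) ^+ (j + (3 - i))
   else (b j)%:~R * (m * (1 - w) ^+ (j - i.+1))).
have il := integral_1subw.
apply: (@dvd5_of_one_subw_exp3 _ y).
  apply: integral_sub; first by apply: integral_mul => //; apply: integral_expr.
  apply: (big_ind integral); [exact: integral0 | by move=> *; apply: integral_add|].
  move=> j _; case: ifP => _; apply: integral_mul; try exact: integral_id.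
    exact: integral_expr.
  by apply: integral_mul => //; apply: integral_expr.
rewrite /y mulrBr [5 * (z * _)]mulrA Ez (bigD1 i') //= mulrDl -mulrA -exprD subnKC //.
rewrite mulr_suml mulr_sumr -addrA -sumrB big1 ?addr0 // => j ji.
rewrite -[(b j)%:~R * _ * _]mulrA -exprD; case: ltnP => [lt_ji|le_ij].
  have /divzK Ebj := IHi j lt_ji (ltn_ord j).
  by rewrite -{1}Ebj intrM; ring.
have lt_ij : (i < j)%N by rewrite ltn_neqAle le_ij andbT eq_sym.
have -> : (j + (3 - i) = 4 + (j - i.+1))%N by lia.
by rewrite exprD one_subw_exp4 -/m; ring.
Qed.

Lemma prim5_sqr_root : root (map_poly intr (quarticF 1 1)) (w ^+ 2).
Proof.
rewrite root_quarticF; apply/eqP.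
(* Phi_5(x^2) = Phi_5(x) Phi_5(-x). *)
rewrite -[RHS](mulr0 (w ^+ 4 - w ^+ 3 + w ^+ 2 - w + 1)) -prim5_sum; ring.
Qed.

(** Phi_5 divides the minimal polynomial of [w], so [w ^+ 2] is a root of the latter and normality
    gives [s]. The exponent 2 is a primitive root modulo 5. *)
Lemma prim5_gal :
  exists2 s : gal_of {:L}, s \in 'Gal({:L} / 1)%g & s w = w ^+ 2.
Proof.
have [||||s Gs sw] := @normalField_root_minPoly _ L 1%AS {:L}%AS w (w ^+ 2).
- exact: subvf.
- exact: normalFieldf.
- exact: memvf.
- have /polyOver1P[r Er] := minPolyOver 1 w.
  have := root_minPoly 1 w; rewrite Er => rw.
  have fw : root (map_poly (in_alg L) (toQ (quarticF 1 1))) w.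
    by rewrite -map_intr_toQ prim5_root.
  have := irreducible_root_dvdp irreducible_quarticF11 fw rw.
  rewrite -(dvdp_map (in_alg L)) -map_intr_toQ => /dvdpP[h ->].
  by rewrite rootM prim5_sqr_root orbT.
by exists s.
Qed.

Lemma root_gal (s : gal_of {:L}) (p : {poly int}) x :
  root (map_poly intr p) x -> root (map_poly intr p) (s x).
Proof.
move=> px; apply/rootP; have := congr1 s (rootP px).
rewrite rmorph0 -horner_map /= -map_poly_comp => <-.
by congr (_.[_]); apply: eq_map_poly => i /=; rewrite rmorph_int.
Qed.

Lemma integral_gal (s : gal_of {:L}) x : integral x -> integral (s x).
Proof. by case=> p monp px; exists p => //; apply: root_gal. Qed.

(** The exponents n, 2n, 4n, 8n run over all nonzero classes modulo 5, unless 5 divides n. *)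
Lemma prim5_trace (s : gal_of {:L}) n : s w = w ^+ 2 ->
  w ^+ n + s (w ^+ n) + s (s (w ^+ n)) + s (s (s (w ^+ n))) =
  if (5 %| n)%N then 4 else -1.
Proof.
move=> sw; have sX k : s (w ^+ k) = w ^+ (2 * k) by rewrite rmorphXn /= sw -exprM.
rewrite !sX -(prim_expr_mod prim_w n) -(prim_expr_mod prim_w (2 * n)).
rewrite -(prim_expr_mod prim_w (2 * (2 * n))).
rewrite -(prim_expr_mod prim_w (2 * (2 * (2 * n)))) !mulnA -(modnMmr 2) -(modnMmr (2 * 2)).
rewrite -(modnMmr (2 * 2 * 2)) /dvdn; have := ltn_pmod n (isT : 0 < 5)%N.
case: (n %% 5)%N => [|[|[|[|[|//]]]]] _ /=; rewrite ?expr0; try ring.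
all: by apply/eqP; rewrite -subr_eq0 -prim5_sum; apply/eqP; rewrite opprK; ring.
Qed.

Hypothesis gen_w : <<1; w>>%VS = {:L}%VS.

Lemma prim5_rat_coef (z : L) : exists2 q : {poly rat},
  (size q <= 4)%N & z = (map_poly (in_alg L) q).[w].
Proof.
have /Fadjoin_polyP[_ /polyOver1P[p ->] ->] : z \in <<1; w>>%VS.
  by rewrite gen_w memvf.
have szf : size (toQ (quarticF 1 1)) = 5%N by rewrite size_toQ polyseq_quarticF.
exists (p %% toQ (quarticF 1 1)).
  by rewrite -ltnS -szf ltn_modp -size_poly_gt0 szf.
rewrite {1}(divp_eq p (toQ (quarticF 1 1))) rmorphD rmorphM /= hornerD hornerM.
by rewrite -[X in _ * X.[w]]map_intr_toQ (rootP prim5_root) mulr0 add0r.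
Qed.

(** The trace of [w^(i + 5 - j) - w^(i + 1)] is 4 + 1 if [i = j] and -1 + 1 otherwise. The exponent
    [5 - j] stands for [- j], and subtracting [w] cancels the terms with [i] different from [j]. *)
Lemma prim5_trace_coef (q : {poly rat}) j (s : gal_of {:L}) :
    s w = w ^+ 2 -> (size q <= 4)%N -> (j < 4)%N ->
  let x := (map_poly (in_alg L) q).[w] * (w ^+ (5 - j) - w) in
  x + s x + s (s x) + s (s (s x)) = (5 * q`_j)%:A.
Proof.
move=> sw szq j4 x.
have -> : x = \sum_(i < 4) (q`_i)%:A * (w ^+ (i + (5 - j)) - w ^+ i.+1).
  rewrite /x (@horner_coef_wide _ 4) ?(leq_trans (size_poly _ _)) // mulr_suml.
  by apply: eq_bigr => i _; rewrite coef_map /= -mulrA mulrBr -exprD -exprSr.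
have sA (c : rat) y : s (c%:A * y) = c%:A * s y by rewrite rmorphM /= rmorph_alg.
rewrite !rmorph_sum /= -!big_split /=.
have TE (c : rat) a b : (5 %| b)%N = false ->
    c%:A * (w ^+ a - w ^+ b) + s (c%:A * (w ^+ a - w ^+ b))
    + s (s (c%:A * (w ^+ a - w ^+ b))) + s (s (s (c%:A * (w ^+ a - w ^+ b)))) =
    c%:A * (if (5 %| a)%N then 5 else 0).
  move=> b5; have := prim5_trace b sw; rewrite b5 => Tb; have Ta := prim5_trace a sw.
  rewrite !sA -!mulrDr !rmorphB /=; congr (_ * _).
  set T := if _ then _ else _ in Ta.
  transitivity (T - -1); last by rewrite /T; case: ifP => _; ring.
  by rewrite -Ta -Tb; ring.
rewrite (eq_bigr (fun i : 'I_4 => (q`_i)%:A * (if (i == j :> nat) then 5 else 0))).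
  rewrite (bigD1 (Ordinal j4)) //= eqxx big1 ?addr0 => [|i ij].
    by rewrite -[RHS]/(in_alg L _) rmorphM rmorph_nat mulrC.
  by rewrite (negPf (_ : i != j :> nat)) ?mulr0.
move=> i _; rewrite TE; last by case: i => -[|[|[|[]]]].
by congr (_ * _); case: i => i i4 /=; case: eqP => ij; case: ifP => //; lia.
Qed.

Lemma prim5_integral_basis (z : L) : integral z ->
  exists2 p : {poly int}, (size p <= 4)%N & z = (map_poly intr p).[w].
Proof.
move=> iz; have [q szq Eq] := prim5_rat_coef z; have [s Gs sw] := prim5_gal.
have iw := prim5_integral.
have int5q j : (j < 4)%N -> 5 * q`_j \is a Num.int.
  move=> j4; apply: (@integral_rat_int L); rewrite -(prim5_trace_coef sw szq j4) -Eq.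
  set x := z * _; have ix : integral x.
    by apply: integral_mul => //; apply: integral_sub => //; apply: integral_expr.
  by do 3 (apply: integral_add; last by do ?apply: integral_gal).
pose P : {poly int} := \poly_(j < 4) numq (5 * q`_j).
(* [P \Po l] carries the coefficients of [5 * z] in powers of [1 - w]. As [l] is its own inverse
   under composition, composing with it again returns to powers of [w]. *)
pose l : {poly int} := 1 - 'X.
have szl : size l = 2%N by rewrite /l -opprB size_polyN size_XsubC.
have szPl : (size (P \Po l) <= 4)%N by rewrite size_comp_poly2 // size_poly.
have lE x : (map_poly intr l).[x] = 1 - x :> L.
  by rewrite /l rmorphB /= map_polyX rmorph1 !hornerE.
have E5 : 5 * z = (map_poly intr P).[w].
  rewrite Eq (@horner_coef_wide _ 4) ?(leq_trans (size_poly _ _)) //.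
  rewrite (@horner_coef_wide _ 4); last by rewrite !(leq_trans (size_poly _ _)).
  rewrite mulr_sumr; apply: eq_bigr => i _; rewrite !coef_map coef_poly ltn_ord /= mulrA.
  congr (_ * _); rewrite -(rmorph_int (in_alg L)) numqK ?int5q //.
  by rewrite -[RHS]/(in_alg L _) rmorphM rmorph_nat.
have d5 : forall i, (i < 4)%N -> (5 %| (P \Po l)`_i)%Z.
  apply: (dvd5_one_subw_coef iz); rewrite E5.
  rewrite -[w in LHS](subKr 1) -(lE (1 - w)) -horner_comp -map_comp_poly.
  rewrite (@horner_coef_wide _ 4) ?(leq_trans (size_poly _ _)) //.
  by apply: eq_bigr => i _; rewrite coef_map.
pose r : {poly int} := \poly_(i < 4) ((P \Po l)`_i %/ 5)%Z.
exists (r \Po l); first by rewrite size_comp_poly2 // size_poly.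
apply: (mulfI five_neq0); rewrite E5.
have -> : P = (5 *: r) \Po l.
  have -> : 5 *: r = P \Po l.
    apply/polyP => i; rewrite coefZ coef_poly; case: ltnP => i4.
      by rewrite mulrC divzK ?d5.
    by rewrite mulr0 nth_default // (leq_trans szPl).
  have ll : l \Po l = 'X by rewrite /l comp_polyB comp_polyX -polyC1 comp_polyC; ring.
  by rewrite -comp_polyA ll comp_polyXr.
by rewrite comp_polyZ map_polyZ hornerZ rmorph_nat.
Qed.

Lemma prim5_Galois_group : Galois_group_isog (quarticF 1 1) (Zp_group 4).
Proof.
pose rs := [:: w; w ^+ 2; w ^+ 3; w ^+ 4].
have rsL : <<1 & rs>>%VS = {:L}%VS.
  apply/eqP; rewrite eqEsubv subvf -gen_w /= -adjoin_seq1.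
  by rewrite adjoin_seqSr // => x; rewrite inE => /eqP ->; apply: mem_head.
have frs : map_poly intr (quarticF 1 1) = \prod_(r <- rs) ('X - r%:P) :> {poly L}.
  (* Cancel [X - 1] from the factorization of [X^5 - 1]. *)
  have := factor_Xn_sub_1 prim_w.
  rewrite big_mkord !big_ord_recl big_ord0 /= mulr1 => E.
  apply: (@mulfI _ ('X - 1%:P)); first by rewrite polyXsubC_eq0.
  rewrite !big_cons big_nil mulr1 [RHS]E /quarticF !rmorphD /= !map_polyZ !map_polyXn.
  by rewrite map_polyX !rmorph1 !scale1r; ring.
exists L; split; first by exists rs; rewrite // frs eqpxx.
have [s Gs sw] := prim5_gal.
have sX k : s (w ^+ k) = w ^+ (2 * k) by rewrite rmorphXn /= sw -exprM.
have gal_w (x y : gal_of {:L}) : x w = y w -> x = y.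
  move=> xy; apply: (mulIg y^-1%g); rewrite mulgV.
  apply: (@gal_eq1 _ [:: w]); first by rewrite adjoin_seq1 gen_w.
  by move=> _ /[1!inE] /eqP ->; rewrite galM ?memvf // xy -galM ?memvf // mulgV gal_id.
have swk k : (s ^+ k)%g w = w ^+ (2 ^ k).
  elim: k => [|k IHk]; first by rewrite expg0 gal_id.
  by rewrite expgSr galM ?memvf // IHk sX expnS.
(* An automorphism is determined by the image of [w], and each of the four roots is some
   [w ^+ (2 ^ k)]; for instance [w^3 = w^8]. *)
have GE : 'Gal({:L} / 1)%g = <[s]>%g.
  apply/eqP; rewrite eqEsubset cycle_subG Gs andbT; apply/subsetP => x _.
  have : x w \in rs.
    by rewrite -root_prod_XsubC -frs; apply: root_gal prim5_root.
  have wk k m : w ^+ m = w ^+ (2 ^ k) -> x w = w ^+ m -> x \in <[s]>%g.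
    by rewrite -swk => -> /gal_w ->; apply: mem_cycle.
  rewrite !inE => /or4P[] /eqP.
  - exact: (@wk 0%N 1%N).
  - exact: (@wk 1%N 2%N).
  - by apply: (@wk 3%N); apply/eqP; rewrite (eq_prim_root_expr prim_w).
  - exact: (@wk 2%N 4%N).
have s4 : #[s]%g = 4%N.
  have s2 : (s ^+ 2)%g != 1%g.
    apply/eqP => s2; have := swk 2%N; rewrite s2 gal_id => /eqP.
    by rewrite -[X in X == _]expr1 (eq_prim_root_expr prim_w).
  have : (#[s]%g %| 4)%N.
    rewrite order_dvdn; apply/eqP/gal_w; rewrite swk gal_id.
    by apply/eqP; rewrite -[X in _ == X]expr1 (eq_prim_root_expr prim_w).
  rewrite -order_dvdn in s2; move: s2; case: #[s]%g => [|[|[|[|[|n]]]]] //.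
have cycG : cyclic 'Gal({:L} / 1)%g by rewrite GE cycle_cyclic.
have cardG : #|'Gal({:L} / 1)%g| = 4%N by rewrite GE -orderE s4.
by rewrite (isog_cyclic_card _ cycG) cyclic_Zp_group card_Zp // cardG.
Qed.

(** Coordinates exist by [prim5_integral_basis]; they are unique because no nonzero integer
    polynomial of degree below 4 vanishes at [w]. *)
Lemma monogenic_quarticF11 : monogenic (quarticF 1 1).
Proof.
split; [exact: quarticF_monic | exact: irreducible_quarticF11 |].
have szf : size (quarticF 1 1) = 5%N by rewrite polyseq_quarticF.
exists L, w; split; first exact: prim5_root.
split=> [i|z [_ iz]].
  by split; [apply: rpredX; apply: memv_adjoin | apply: integral_expr prim5_integral].
have [p szp Ez] := prim5_integral_basis iz.
exists [ffun i : 'I__ => p`_i]; split.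
  rewrite Ez (@horner_coef_wide _ (size (quarticF 1 1)).-1); last first.
    by rewrite szf (leq_trans (size_poly _ _)).
  by apply: eq_bigr => i _; rewrite coef_map ffunE /= mulrzl.
move=> c; rewrite -horner_poly_of_ffun => Ec.
have /eqP : p - poly_of_ffun c = 0.
  apply: (intr_root_size irreducible_quarticF11 prim5_root).
    rewrite [X in (_ < X)%N]szf ltnS (leq_trans (size_polyD _ _)) // size_polyN geq_max szp.
    by rewrite (leq_trans (size_poly _ _)) // szf.
  by rewrite rootE rmorphB /= hornerD hornerN -Ez -Ec subrr.
rewrite subr_eq0 => /eqP ->; apply/ffunP => i.
by rewrite ffunE coef_poly ltn_ord valK.
Qed.

End CyclotomicField5.

Theorem theorem1p2 (A B : int)
    (hA : (A = 1 %[mod 4])%Z) (hB : (B = 1 %[mod 4])%Z) :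
  (monogenic (quarticF A B) /\ Galois_group_isog (quarticF A B) (Zp_group 4))
  <-> (A = 1 /\ B = 1).
Proof.
split=> [[mon gal]|[-> ->]].
  have [_ irrf _] := mon; have [X EX] := cyclic_quarticF_square irrf gal.
  apply: (cyclic_quartic_arith hA hB _ _ _ EX).
  - apply: monogenic_squarefree_disc => //; last by lia.
    by apply/eqP; clear -hA hB; have := divz_eq A 4; have := divz_eq B 4; nia.
  - have := @monogenic_squarefree_eval A B 1 mon; rewrite mulr1; apply=> //.
    by apply/eqP; lia.
  have := @monogenic_squarefree_eval A B (-1) mon; rewrite mulrN1 mulNr; apply=> //.
  by apply/eqP; lia.
(* A group of order 5 is supplied to obtain a number field generated by a primitive fifth root of
   unity. *)
have [L _ [_ _ [w [pw gw] _]]] := group_num_field_exists (Zp_group 5).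
rewrite card_Zp // in pw.
by split; [apply: monogenic_quarticF11 pw gw | apply: prim5_Galois_group pw gw].
Qed.
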